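(* Let $a$ and $b$ be positive multiples of $8$ such that neither $a+1$ nor $b+1$ is divisible by $3$. If there exist universal cycles on the $4$-subsets of $[a+2]$ and on the $4$-subsets of $[b+2]$, then there exists a universal cycle on the $4$-subsets of $[a+b+2]$.
   Context: $[n]=\{0,1,\ldots,n-1\}$. A cycle is a finite nonempty string $C$ of symbols, of length $|C|$; for any integer $x$, $C_x$ denotes the $(x+1)$-th symbol of $C$, with the index read modulo $|C|$ (so the first symbol is $C_0$). A universal cycle on the $k$-subsets of a finite set $\mathcal{A}$ is a cycle $C$ such that, for each $0\le x\le |C|-1$, the $k$ cyclically consecutive symbols $C_x,C_{x+1},\ldots,C_{x+k-1}$ are pairwise distinct elements of $\mathcal{A}$, and every $k$-element subset of $\mathcal{A}$ equals $\{C_x,\ldots,C_{x+k-1}\}$ for exactly one $x\in\{0,\ldots,|C|-1\}$. *)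

(* Defs.v *)
From mathcomp Require Import all_boot all_algebra.

Set Implicit Arguments.
Unset Strict Implicit.
Unset Printing Implicit Defensive.

(* A cycle is a nonempty string, encoded as an (m.+1)-tuple, so |C| = m.+1;
   [inZp x : 'I_m.+1] is x modulo m.+1. Natural indices suffice here. *)
Definition cycle_sym (T : Type) (m : nat) (C : m.+1.-tuple T) (x : nat) : T :=
  tnth C (inZp x).

Definition cycle_window (T : finType) (m k : nat) (C : m.+1.-tuple T)
    (x : nat) : {set T} :=
  [set cycle_sym C (x + i) | i : 'I_k].

Definition universal_cycle (T : finType) (k : nat) (A : {set T})
    (m : nat) (C : m.+1.-tuple T) : Prop :=
  (forall x : 'I_m.+1,
     injective (fun i : 'I_k => cycle_sym C (x + i)) /\
     (forall i : 'I_k, cycle_sym C (x + i) \in A)) /\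
  (forall S : {set T}, S \subset A -> #|S| = k ->
     exists! x : 'I_m.+1, S = cycle_window k C x).

(* The set {0, 1, ..., n-1} is the full set of 'I_n. *)
Definition has_universal_cycle (k n : nat) : Prop :=
  exists (m : nat) (C : m.+1.-tuple 'I_n), universal_cycle k [set: 'I_n] C.

(* Main.v *)
Require Import Defs.
From mathcomp Require Import all_boot.
From mathcomp Require Import fingroup perm zmodp zify.

(** Write the a + b + 2 symbols as A + B with |A| = a + 1 and |B| = b + 1, both
    parts odd cyclic groups, and let p be the last element of B, q the last one
    of A. A universal cycle is an Eulerian circuit: its windows are the edges of
    a digraph whose vertices are the words of length k - 1, a window going from
    its prefix to its suffix. So it suffices to order every 4-subset so that
    the resulting digraph has a permutation sending each edge to a following
    one (a [tour]) and is connected; [euler_circuit] then merges the orbits of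
    that permutation into one.

    The 4-subsets are ordered according to the number of their elements in A.
     - Two elements in A and two in B: an element pair of A is written x, x + d
       with 1 <= d <= a / 2, a pair of B likewise with difference d', and the
       two pairs are interleaved, starting in A or in B according to the parity
       of d + d' ([alternate_tour]). As a / 2 and b / 2 are even, both parities
       are equally frequent, which is what balances the digraph.
     - Three or four in A: if the set lies in A + p, its order is that of the
       given universal cycle on a + 2 symbols. Otherwise it is a triple of A
       with a symbol of B other than p. The triples of A are ordered by a
       universal cycle u on the 3-subsets of A ([triple_cycle]), which exists
       since 3 does not divide a + 1; its length C(a + 1, 3) is a multiple
       of 4, so the position of the triple in u, modulo 4, can decide at which
       of the four places the extra symbol is inserted ([insert_tour]).
     - Three or four in B: the same with A and B exchanged, q replacing p.

    For connectedness, all the alternating windows are connected together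
    because differences of both parities can be used freely
    ([alternate_connected]); every inserted window is connected to a word
    x, y, x + d with y in B, which is the prefix of an alternating window; and
    the symbols of the given universal cycles are renamed so that they contain
    such a word, 0, p, 1 or 0, q, 1 ([side_tour]). *)

Set Implicit Arguments.
Unset Strict Implicit.
Unset Printing Implicit Defensive.

(** * Eulerian circuits *)

(** Connectedness of the digraph is expressed by two-colourings of its vertices:
    if both ends of every edge have the same colour, then all do. This form
    spares the handling of paths. *)
Definition connected_through (E V : Type) (src dst : E -> V) : Prop :=
  forall c : V -> bool, (forall e, c (src e) = c (dst e)) ->
    forall e f, c (src e) = c (src f).

(** Take a successor permutation with the fewest orbits. If two edges with the
    same end were in different orbits, exchanging their successors would merge
    these orbits; hence the edges of the orbit of e0 are recognised by their
    source, and connectedness makes this orbit the whole set. *)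
Lemma single_orbit_successor (E : finType) (V : eqType) (src dst : E -> V)
    (s0 : E -> E) :
  injective s0 -> (forall e, src (s0 e) = dst e) ->
  connected_through src dst ->
  exists s : {perm E},
    (forall e, src (s e) = dst e) /\ (forall e f, f \in porbit s e).
Proof.
move=> s0_inj s0_next conn.
pose ok (s : {perm E}) := [forall e, src (s e) == dst e].
have ok0 : ok (perm s0_inj) by apply/forallP=> e; rewrite permE s0_next.
case: (arg_minnP (fun s => #|porbits s|) ok0) => s /forallP s_ok s_min.
have s_next e : src (s e) = dst e by apply/eqP.
have merge e f : dst e = dst f -> f \in porbit s e.
  move=> def; apply/negPn/negP=> nef.
  have ok' : ok (tperm e f * s)%g.
    apply/forallP=> x; rewrite permM s_next.
    by case: tpermP => [->|->|] //; rewrite def.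
  have := porbits_mul_tperm s e f; have := s_min _ ok' => /=.
  rewrite porbit_sym in nef; rewrite nef.
  by case: eqP => [ef|_]; [rewrite ef porbit_id in nef | lia].
exists s; split=> // e0 e1.
(* The vertices from which an edge of the orbit of e0 starts. *)
pose c v := [exists e, (src e == v) && (e \in porbit s e0)].
have srcE e : c (src e) = (e \in porbit s e0).
  apply/existsP/idP => [[f /andP[/eqP fe fo]]|eo]; last by exists e; rewrite eqxx.
  have := merge ((s^-1)%g f) ((s^-1)%g e).
  rewrite -!s_next !permKV => /(_ fe).
  rewrite -!eq_porbit_mem => /eqP eqo.
  have inv x : porbit s ((s^-1)%g x) = porbit s x.
    by apply/eqP; rewrite eq_porbit_mem -{2}[x](permKV s) porbit_sym; 
       apply: (mem_porbit s 1).
  by move: eqo fo; rewrite !inv -!eq_porbit_mem => ->.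
have nextE e : c (src e) = c (dst e).
  rewrite -s_next !srcE -!eq_porbit_mem.
  by have /eqP -> : porbit s (s e) == porbit s e 
    by rewrite eq_porbit_mem; apply: (mem_porbit s 1).
by rewrite -srcE (conn c nextE e1 e0) srcE porbit_id.
Qed.

Lemma euler_circuit (E : finType) (V : eqType) (src dst : E -> V)
    (s0 : E -> E) :
  injective s0 -> (forall e, src (s0 e) = dst e) ->
  connected_through src dst ->
  exists t : 'I_#|E| -> E,
    bijective t /\ (forall i, src (t (ordS i)) = dst (t i)).
Proof.
move=> s0_inj s0_next conn.
have [E0|/card_gt0P[e0 _]] := posnP #|E|.
  have noI (i : 'I_#|E|) : False by case: i => i; rewrite E0.
  have t (i : 'I_#|E|) : E by case: (noI i).
  exists t; split=> [|i]; last by case: (noI i).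
  apply: inj_card_bij => [i|]; first by case: (noI i).
  by rewrite card_ord.
have [s [s_next s_orb]] := single_orbit_successor s0_inj s0_next conn.
have cardE : #|porbit s e0| = #|E|.
  by apply: eq_card => e; rewrite s_orb.
exists (fun i => iter i s e0); split=> [|i].
  apply: inj_card_bij => [i j|]; last by rewrite card_ord.
  have := uniq_traject_porbit s e0; rewrite cardE => /uniqP - /(_ e0) u.
  move=> eij; apply: val_inj; apply: u; rewrite ?inE ?size_traject ?ltn_ord //.
  by rewrite !nth_traject ?ltn_ord.
rewrite -s_next /= -iterS.
have [ei|ne] := eqVneq i.+1 #|E|.
  by have := iter_porbit s e0; rewrite cardE ei modnn => ->.
by rewrite modn_small // ltn_neqAle ne ltn_ord.
Qed.

(** * Tours *)

(** A way to order each k-subset satisfying P exactly once, as the windows w e,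
    together with a permutation s that sends every window to one that can follow
    it in a string: a set of disjoint cyclic strings whose windows are the
    k-subsets satisfying P. *)
Record tour (T E : finType) (k : nat) (P : {set T} -> Prop)
    (w : E -> seq T) (s : E -> E) : Prop := Tour {
  tour_inj : injective s;
  tour_size : forall e, size (w e) = k;
  tour_uniq : forall e, uniq (w e);
  tour_next : forall e, take k.-1 (w (s e)) = behead (w e);
  tour_in : forall e, P [set z in w e];
  tour_once : injective (fun e => [set z in w e]);
  tour_all : forall S : {set T}, #|S| = k -> P S ->
    exists e, [set z in w e] = S
}.

(** A colouring of the words of length k - 1 that is constant along the windows,
    as in [connected_through]. *)
Definition tour_invariant (T E : Type) (k : nat) (w : E -> seq T)
    (c : seq T -> bool) : Prop :=
  forall e, c (take k.-1 (w e)) = c (behead (w e)).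

Lemma tour_circuit (T E : finType) (k : nat) (P : {set T} -> Prop)
    (w : E -> seq T) (s : E -> E) :
  tour k P w s ->
  (forall c, tour_invariant k w c ->
     forall e f, c (take k.-1 (w e)) = c (take k.-1 (w f))) ->
  exists t : 'I_#|E| -> E, tour k P (w \o t) (@ordS _).
Proof.
move=> [s_inj w_size w_uniq w_next w_in w_once w_all] conn.
have [t [t_bij t_next]] := euler_circuit s_inj w_next conn.
exists t; split=> //=; first exact: ordS_inj.
  exact: inj_comp w_once (bij_inj t_bij).
move=> S cardS PS; have [e <-] := w_all S cardS PS.
by case: t_bij => t' _ t'K; exists (t' e); rewrite /= t'K.
Qed.

Lemma card_tour (T E : finType) (k : nat) (w : E -> seq T) (s : E -> E) :
  tour k (fun=> True) w s -> #|E| = 'C(#|T|, k).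
Proof.
case=> _ w_size w_uniq _ _ w_once w_all; rewrite -card_draws.
rewrite -(card_imset _ w_once); apply: eq_card => S; rewrite inE.
apply/imsetP/eqP => [[e _ ->]|/w_all -/(_ I)[e <-]]; last by exists e.
by rewrite cardsE (card_uniqP (w_uniq e)).
Qed.

Lemma tour_map (T T' E : finType) (k : nat) (f : T -> T')
    (w : E -> seq T) (s : E -> E) :
  injective f -> tour k (fun=> True) w s ->
  tour k (fun S => S \subset codom f) (fun e => map f (w e)) s.
Proof.
move=> f_inj [s_inj w_size w_uniq w_next w_in w_once w_all].
have setE e : [set z in map f (w e)] = f @: [set z in w e].
  apply/setP=> z; rewrite inE.
  by apply/mapP/imsetP=> -[x xw ->]; exists x; rewrite ?inE // in xw *.
split=> // [e|e|e|e|e e'|S cardS sub].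
- by rewrite size_map.
- by rewrite map_inj_uniq.
- by rewrite -map_take w_next behead_map.
- rewrite setE; apply/subsetP=> _ /imsetP[x _ ->]; exact: codom_f.
- by rewrite /= !setE => /(imset_inj f_inj)/w_once.
have fK : f @: (f @^-1: S) = S.
  apply/setP=> z; apply/imsetP/idP=> [[x]|zS]; first by rewrite inE => ? ->.
  by have /codomP[x zx] := subsetP sub z zS; exists x; rewrite // inE -zx.
have [|e def] := w_all (f @^-1: S) _ I.
  by rewrite -(card_imset _ f_inj) fK.
by exists e; rewrite setE def.
Qed.

Definition sum_windows (T E1 E2 : Type) (w1 : E1 -> seq T) (w2 : E2 -> seq T)
    (e : E1 + E2) : seq T :=
  match e with inl e1 => w1 e1 | inr e2 => w2 e2 end.

Definition sum_next (E1 E2 : Type) (s1 : E1 -> E1) (s2 : E2 -> E2)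
    (e : E1 + E2) : E1 + E2 :=
  match e with inl e1 => inl (s1 e1) | inr e2 => inr (s2 e2) end.

Lemma tour_sum (T E1 E2 : finType) (k : nat) (P1 P2 : {set T} -> Prop)
    (w1 : E1 -> seq T) (w2 : E2 -> seq T) (s1 : E1 -> E1) (s2 : E2 -> E2) :
  (forall S, P1 S -> P2 S -> False) ->
  tour k P1 w1 s1 -> tour k P2 w2 s2 ->
  tour k (fun S => P1 S \/ P2 S) (sum_windows w1 w2) (sum_next s1 s2).
Proof.
move=> disj [s_inj1 w_size1 w_uniq1 w_next1 w_in1 w_once1 w_all1].
case=> [s_inj2 w_size2 w_uniq2 w_next2 w_in2 w_once2 w_all2].
split=> [[e|e] [f|f] //= []||||||].
- by move/s_inj1->.
- by move/s_inj2->.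
- by case.
- by case.
- by case.
- by case=> e; [left; apply: w_in1 | right; apply: w_in2].
- move=> [e|e] [f|f] /= eq_set; first by rewrite (w_once1 _ _ eq_set).
  + by case: (disj [set z in w1 e]); rewrite // eq_set.
  + by case: (disj [set z in w2 e]); rewrite // eq_set.
  + by rewrite (w_once2 _ _ eq_set).
move=> S cardS [/(w_all1 S cardS)|/(w_all2 S cardS)] [e def].
  by exists (inl e).
by exists (inr e).
Qed.

Lemma tour_ext (T E : finType) (k : nat) (P Q : {set T} -> Prop)
    (w : E -> seq T) (s : E -> E) :
  (forall S : {set T}, #|S| = k -> P S <-> Q S) -> tour k P w s -> tour k Q w s.
Proof.
move=> PQ [s_inj w_size w_uniq w_next w_in w_once w_all]; split=> //.
  by move=> e; apply/PQ; rewrite // cardsE (card_uniqP (w_uniq e)).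
by move=> S cardS QS; apply: w_all => //; apply/PQ.
Qed.

(** * Tours and universal cycles *)

(** The windows of a universal cycle form a tour with a single orbit, and
    conversely a tour indexed cyclically is a universal cycle: its symbols are
    the first letters of the windows. *)
Lemma universal_cycle_tour (T : finType) (k m : nat) (C : m.+1.-tuple T) :
  universal_cycle k [set: T] C ->
  tour k (fun=> True)
    (fun x : 'I_m.+1 => [seq cycle_sym C (x + i) | i <- iota 0 k]) (@ordS _).
Proof.
move=> [C_inj C_all].
have setE x : [set z in [seq cycle_sym C (x + i) | i <- iota 0 k]]
              = cycle_window k C x.
  apply/setP=> z; rewrite inE; apply/mapP/imsetP=> [[i]|[i _ ->]].
    by rewrite mem_iota /= => ik ->; exists (Ordinal ik).
  by exists (val i); rewrite // mem_iota /=.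
have cardC (x : 'I_m.+1) : #|cycle_window k C x| = k.
  by rewrite card_imset ?card_ord; last by case: (C_inj x).
split=> // [|x|x|x|x x'|S cardS _].
- exact: ordS_inj.
- by rewrite size_map size_iota.
- rewrite map_inj_in_uniq ?iota_uniq // => i j; rewrite !mem_iota /= => ik jk.
  have [inj _] := C_inj x; move=> /(inj (Ordinal ik) (Ordinal jk)).
  by move/(congr1 val).
- case: (k) => [|k'] //; rewrite -[k'.+1.-1]/k' -map_take take_iota.
  have -> /= : minn k' k'.+1 = k' by lia.
  rewrite -[1]addn0 iotaDl -map_comp; apply: eq_map => i /=.
  by rewrite /cycle_sym; congr tnth; apply: val_inj; rewrite /= modnDml addSnnS.
- rewrite /= !setE => eq_w.
  have [y [_ y_uniq]] := C_all (cycle_window k C x) (subsetT _) (cardC x).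
  by rewrite -(y_uniq x) // -(y_uniq x').
have [x [-> _]] := C_all S (subsetT _) cardS.
by exists x; rewrite setE.
Qed.

Lemma tour_universal_cycle (T : finType) (k m : nat) (w : 'I_m.+1 -> seq T) :
  0 < k -> tour k (fun=> True) w (@ordS _) ->
  exists C : m.+1.-tuple T, universal_cycle k [set: T] C.
Proof.
move=> k_gt0 [_ w_size w_uniq w_next w_in w_once w_all].
have [x0 _] : exists x0, x0 \in w ord0.
  have: 0 < size (w ord0) by rewrite w_size.
  by case: (w ord0) => // x0 l _; exists x0; apply: mem_head.
pose C := [tuple head x0 (w i) | i < m.+1]; exists C.
have CE (x : 'I_m.+1) i : i < k -> cycle_sym C (x + i) = nth x0 (w x) i.
  elim: i x => [|i IH] x ik.
    by rewrite addn0 /cycle_sym tnth_mktuple valZpK nth0.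
  have -> : cycle_sym C (x + i.+1) = cycle_sym C (ordS x + i).
    by rewrite /cycle_sym; congr tnth; apply: val_inj; 
       rewrite /= modnDml addSnnS.
  rewrite IH ?(ltnW ik) // -[nth _ _ i.+1]nth_behead -w_next nth_take //; lia.
have setE (x : 'I_m.+1) : cycle_window k C x = [set z in w x].
  apply/setP=> z; rewrite inE; apply/imsetP/idP=> [[i _ ->]|zw].
    by rewrite CE // mem_nth ?w_size.
  have ik : index z (w x) < k by rewrite -(w_size x) index_mem.
  by exists (Ordinal ik); rewrite // CE // nth_index.
split=> [x|S _ cardS].
  split=> [i j|i]; last by rewrite inE.
  rewrite !CE // => /eqP; rewrite nth_uniq ?w_size // => /eqP; exact: val_inj.
have [x def] := w_all S cardS I; exists x; split=> [|y]; first by rewrite setE.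
by rewrite setE -def => /w_once.
Qed.

(** * Shifts modulo n *)

Definition shift (n : nat) (x : 'I_n.+1) (d : nat) : 'I_n.+1 := inZp (x + d).

Lemma shiftD n (x : 'I_n.+1) d e : shift (shift x d) e = shift x (d + e).
Proof. by apply: val_inj; rewrite /= modnDml addnA. Qed.

Lemma shift0 n (x : 'I_n.+1) : shift x 0 = x.
Proof. by rewrite /shift addn0 valZpK. Qed.

Lemma shift_period n (x : 'I_n.+1) : shift x n.+1 = x.
Proof. by apply: val_inj; rewrite /= modnDr modn_small. Qed.

Lemma shift_eq n (x : 'I_n.+1) d e :
  d <= n -> e <= n -> shift x d = shift x e -> d = e.
Proof.
move=> dn en /(congr1 val) /= /eqP; rewrite eqn_modDl !modn_small //.
by move/eqP.
Qed.

Lemma shift_neq n (x : 'I_n.+1) d : 0 < d -> d <= n -> shift x d <> x.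
Proof.
by move=> d0 dn; rewrite -{2}[x]shift0 => /(shift_eq dn (leq0n n)) d0'; lia.
Qed.

Lemma shift_inj n d : injective (fun x : 'I_n.+1 => shift x d).
Proof.
move=> x y /(congr1 val) /= /eqP.
by rewrite eqn_modDr !modn_small // => /eqP; apply: val_inj.
Qed.

(** The cyclic distance from x to y. *)
Lemma gapP n (x y : 'I_n.+1) : exists2 d, d <= n & y = shift x d.
Proof.
exists ((y + (n.+1 - x)) %% n.+1); first by rewrite -ltnS ltn_mod.
apply: val_inj; rewrite /= modnDmr.
have -> : x + (y + (n.+1 - x)) = y + n.+1 by have := ltn_ord x; lia.
by rewrite modnDr modn_small.
Qed.

Lemma unshift n (y : 'I_n.+1) d : exists x : 'I_n.+1, y = shift x d.
Proof.
have [e _ def] := gapP (shift y d) y; exists (shift y e).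
by rewrite shiftD addnC -shiftD -def.
Qed.

Lemma shift1_invariant n (X : Type) (F : 'I_n.+1 -> X) :
  (forall x, F (shift x 1) = F x) -> forall x y, F x = F y.
Proof.
move=> F1 x y; have [d _ ->] := gapP x y; elim: d => [|d IH].
  by rewrite shift0.
by rewrite -addn1 -shiftD F1.
Qed.

(** 2 generates the group because its order is odd. *)
Lemma shift2_invariant h (X : Type) (F : 'I_h.*2.+1 -> X) :
  (forall x, F (shift x 2) = F x) -> forall x y, F x = F y.
Proof.
move=> F2; apply: shift1_invariant => x.
have F2k k z : F (shift z k.*2) = F z.
  elim: k => [|k IH]; first by rewrite shift0.
  by rewrite doubleS -addn2 -shiftD F2.
by rewrite -(F2k h (shift x 1)) shiftD shift_period.
Qed.

Lemma set_in_perm (T : finType) (l l' : seq T) :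
  perm_eq l l' -> [set z in l] = [set z in l'].
Proof. by move/perm_mem=> eq_l; apply/setP=> z; rewrite !inE eq_l. Qed.

Lemma cards_uniq (T : finType) (S : {set T}) k :
  #|S| = k -> exists l : seq T, [/\ uniq l, size l = k & S = [set z in l]].
Proof.
move=> <-; exists (enum S); rewrite enum_uniq -cardE; split=> //.
by apply/setP=> z; rewrite inE mem_enum.
Qed.

(** * Two-element sets *)

Lemma pair_uniq h (x : 'I_h.*2.+1) (d : 'I_h) : uniq [:: x; shift x d.+1].
Proof.
rewrite /= inE andbT; apply/eqP => /esym; apply: shift_neq => //.
by have := ltn_ord d; lia.
Qed.

(** A pair x, y of distinct elements has two distances, from x to y and from y
    to x, of sum 2h + 1: exactly one of them is at most h. *)
Lemma pair_once h (x y : 'I_h.*2.+1) (d e : 'I_h) :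
  [set z in [:: x; shift x d.+1]] = [set z in [:: y; shift y e.+1]] ->
  x = y /\ d = e.
Proof.
have := ltn_ord d; have := ltn_ord e => eh dh.
move/setP=> eq_set; have := eq_set y; rewrite !inE eqxx /=.
case/orP=> /eqP def.
  subst y; split=> //; have := eq_set (shift x e.+1); rewrite !inE eqxx orbT.
  case/orP=> /eqP; first by move/shift_neq; case; lia.
  move/shift_eq => eq_ed; apply: val_inj; have := eq_ed; rewrite /=; lia.
have := eq_set x; rewrite !inE eqxx def /= shiftD => /esym.
case/orP=> /eqP /esym; first by move/shift_neq; case; lia.
by move/shift_neq; case; lia.
Qed.

Lemma pair_all h (S : {set 'I_h.*2.+1}) : #|S| = 2 ->
  exists (x : 'I_h.*2.+1) (d : 'I_h), S = [set z in [:: x; shift x d.+1]].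
Proof.
case/cards_uniq=> l; case: l => [|x [|y [|? ?]]] [] //= /andP[xy _] _ ->.
have [[|d] dn def] := gapP x y; subst y.
  by rewrite shift0 inE eqxx in xy.
have [dh|hd] := ltnP d h; first by exists x, (Ordinal dh).
have eh : h.*2 - d.+1 < h by lia.
exists (shift x d.+1), (Ordinal eh); rewrite /= shiftD.
have -> : d.+1 + (h.*2 - d.+1).+1 = h.*2.+1 by lia.
by rewrite shift_period; apply: set_in_perm; rewrite (perm_catC [:: x] [:: _]).
Qed.

(** * Three-element sets *)

(** A triple on the circle of length 2h + 1 has three cyclic gaps, up to
    rotation; it is read from the element after its distinguished gap d3, so
    that the other two, d1 and d2, are the differences read. The distinguished
    gap is the odd one out if two gaps are equal, and otherwise the largest one
    for an order where h comes first. Since this choice does not depend on the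
    orientation, (d2, d1) is good when (d1, d2) is, and the string with
    alternating differences d1, d2 runs through the two mirror classes. Putting
    h first lets it occur beside the difference 2; with the usual order it would
    only occur as (h, h), and the strings of difference h would be isolated. *)
Definition gap_key (h d : nat) : nat := if d == h then 0 else d.

Definition good_gaps (h d1 d2 : nat) : bool :=
  let d3 := h.*2.+1 - (d1 + d2) in
  [&& 0 < d1, 0 < d2, d1 + d2 < h.*2.+1 &
      (d1 == d2) || (gap_key h d1 < gap_key h d3) && (gap_key h d2 < gap_key h d3)].

Lemma good_gaps_sym h d1 d2 : good_gaps h d1 d2 = good_gaps h d2 d1.
Proof.
rewrite /good_gaps [d2 + d1]addnC [d2 == _]eq_sym [_ && (gap_key h d1 < _)]andbC.
by rewrite andbCA.
Qed.

Lemma good_gaps_le h d1 d2 : good_gaps h d1 d2 -> d1 <= h.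
Proof. rewrite /good_gaps /gap_key; do !case: eqP; lia. Qed.

(** Equal gaps are excluded because 3 does not divide the length. *)
Lemma good_gaps_rot h d1 d2 d3 : ~~ (3 %| h.*2.+1) ->
  0 < d1 -> 0 < d2 -> 0 < d3 -> d1 + d2 + d3 = h.*2.+1 ->
  [|| good_gaps h d1 d2, good_gaps h d2 d3 | good_gaps h d3 d1].
Proof.
move=> n3 d1_gt0 d2_gt0 d3_gt0 sum.
rewrite /good_gaps /gap_key -sum.
have -> : d1 + d2 + d3 - (d1 + d2) = d3 by lia.
have -> : d1 + d2 + d3 - (d2 + d3) = d1 by lia.
have -> : d1 + d2 + d3 - (d3 + d1) = d2 by lia.
do !case: eqP; lia.
Qed.

Lemma good_gaps_once h d1 d2 d3 : ~~ (3 %| h.*2.+1) ->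
  0 < d1 -> 0 < d2 -> 0 < d3 -> d1 + d2 + d3 = h.*2.+1 ->
  good_gaps h d1 d2 -> good_gaps h d2 d3 -> False.
Proof.
move=> n3 d1_gt0 d2_gt0 d3_gt0 sum.
rewrite /good_gaps /gap_key -sum.
have -> : d1 + d2 + d3 - (d1 + d2) = d3 by lia.
have -> : d1 + d2 + d3 - (d2 + d3) = d1 by lia.
do !case: eqP; lia.
Qed.

Definition arc3 n (x : 'I_n.+1) (d1 d2 : nat) : seq 'I_n.+1 :=
  [:: x; shift x d1; shift x (d1 + d2)].

Lemma arc3_uniq n (x : 'I_n.+1) d1 d2 :
  0 < d1 -> 0 < d2 -> d1 + d2 <= n -> uniq (arc3 x d1 d2).
Proof.
move=> d1_gt0 d2_gt0 le_n; rewrite /= !inE andbT negb_or -andbA.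
apply/and3P; split; apply/eqP=> /esym.
- by apply: shift_neq; lia.
- by apply: shift_neq; lia.
by rewrite -shiftD; apply: shift_neq; lia.
Qed.

Lemma arc3_rot n (x : 'I_n.+1) d1 d2 d3 : d1 + d2 + d3 = n.+1 ->
  [set z in arc3 (shift x d1) d2 d3] = [set z in arc3 x d1 d2].
Proof.
move=> sum; rewrite /arc3 !shiftD addnA sum shift_period.
by apply: set_in_perm; rewrite (perm_catC [:: _; _] [:: _]).
Qed.

(** Two arcs of less than one turn from the same point list the same set in the
    same order. *)
Lemma arc3_base n (x : 'I_n.+1) d1 d2 e1 e2 :
  0 < d1 -> 0 < d2 -> d1 + d2 <= n -> 0 < e1 -> 0 < e2 -> e1 + e2 <= n ->
  [set z in arc3 x d1 d2] = [set z in arc3 x e1 e2] -> d1 = e1 /\ d2 = e2.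
Proof.
move=> d1_gt0 d2_gt0 le_d e1_gt0 e2_gt0 le_e /setP eq_set.
have mem d f1 f2 : 0 < d -> d <= n -> f1 + f2 <= n ->
    shift x d \in arc3 x f1 f2 -> d = f1 \/ d = f1 + f2.
  move=> d_gt0 dn fn; rewrite !inE => /or3P[] /eqP.
  - by move/shift_neq; case.
  - by move/shift_eq; left; lia.
  by move/shift_eq; right; lia.
have E1 : shift x d1 \in arc3 x e1 e2.
  by have := eq_set (shift x d1); rewrite !in_set => <-; rewrite !inE eqxx orbT.
have E2 : shift x (d1 + d2) \in arc3 x e1 e2.
  by have := eq_set (shift x (d1 + d2)); rewrite !in_set => <-;
     rewrite !inE eqxx !orbT.
case: (mem _ _ _ _ _ _ E1); case: (mem _ _ _ _ _ _ E2); lia.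
Qed.

(** Read from a common starting point, the two arcs coincide up to a rotation of
    the gaps, and at most one rotation is good. *)
Lemma arc3_once h (x y : 'I_h.*2.+1) d1 d2 e1 e2 : ~~ (3 %| h.*2.+1) ->
  good_gaps h d1 d2 -> good_gaps h e1 e2 ->
  [set z in arc3 x d1 d2] = [set z in arc3 y e1 e2] ->
  [/\ x = y, d1 = e1 & d2 = e2].
Proof.
move=> n3 gd ge eq_set.
have /and4P[d1_gt0 d2_gt0 lt_d _] := gd; have /and4P[e1_gt0 e2_gt0 lt_e _] := ge.
pose d3 := h.*2.+1 - (d1 + d2).
have d3_gt0 : 0 < d3 by rewrite /d3; lia.
have sum : d1 + d2 + d3 = h.*2.+1 by rewrite /d3; lia.
have : y \in arc3 x d1 d2.
  by have /setP/(_ y) := eq_set; rewrite !in_set mem_head.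
rewrite !inE => /or3P[] /eqP def; subst y.
- by have [] := arc3_base d1_gt0 d2_gt0 lt_d e1_gt0 e2_gt0 lt_e eq_set.
- rewrite -(arc3_rot x sum) in eq_set.
  have [||d2e1 d3e2] := arc3_base d2_gt0 d3_gt0 _ e1_gt0 e2_gt0 _ eq_set; try lia.
  by case: (good_gaps_once n3 d1_gt0 d2_gt0 d3_gt0 sum gd); rewrite d2e1 d3e2.
have sum' : d2 + d3 + d1 = h.*2.+1 by lia.
have sum'' : d3 + d1 + d2 = h.*2.+1 by lia.
rewrite -(arc3_rot x sum) -(arc3_rot _ sum') shiftD in eq_set.
have [||d3e1 d1e2] := arc3_base d3_gt0 d1_gt0 _ e1_gt0 e2_gt0 _ eq_set; try lia.
case: (good_gaps_once n3 d3_gt0 d1_gt0 d2_gt0 sum'' _ gd).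
by rewrite d3e1 d1e2.
Qed.

Lemma arc3_all h (S : {set 'I_h.*2.+1}) : ~~ (3 %| h.*2.+1) -> #|S| = 3 ->
  exists x d1 d2, good_gaps h d1 d2 /\ S = [set z in arc3 x d1 d2].
Proof.
move=> n3 /cards_uniq[l]; case: l => [|x [|y [|z [|? ?]]]] [] //= u _ def.
have [x' [d1 [d2 [d1_gt0 d2_gt0 lt_d ->]]]] : exists x' d1 d2,
    [/\ 0 < d1, 0 < d2, d1 + d2 < h.*2.+1 & S = [set t in arc3 x' d1 d2]].
  rewrite {S}def.
  have [[|d] dn def] := gapP x y; subst y; first by rewrite shift0 inE eqxx in u.
  have [[|e] en def] := gapP x z; subst z.
    by rewrite shift0 !inE eqxx orbT in u.
  have [de|ed|de] := ltngtP d e; last first.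
  - by rewrite de !inE eqxx /= !andbF in u.
  - exists x, e.+1, (d - e); split; try lia; apply: set_in_perm.
    rewrite /arc3; have -> : e.+1 + (d - e) = d.+1 by lia.
    by rewrite perm_cons (perm_catC [:: _] [:: _]).
  exists x, d.+1, (e - d); split; try lia.
  by rewrite /arc3; have -> : d.+1 + (e - d) = e.+1 by lia.
pose d3 := h.*2.+1 - (d1 + d2).
have d3_gt0 : 0 < d3 by rewrite /d3; lia.
have sum : d1 + d2 + d3 = h.*2.+1 by rewrite /d3; lia.
have sum' : d2 + d3 + d1 = h.*2.+1 by lia.
case/or3P: (good_gaps_rot n3 d1_gt0 d2_gt0 d3_gt0 sum) => good.
- by exists x', d1, d2.
- by exists (shift x' d1), d2, d3; rewrite arc3_rot.
by exists (shift (shift x' d1) d2), d3, d1; rewrite !arc3_rot.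
Qed.

(** * A universal cycle on triples *)

(** 6 C(2h + 1, 3) = (2h + 1) 2h (2h - 1). *)
Lemma dvd4_bin3 h : 4 %| h -> 4 %| 'C(h.*2.+1, 3).
Proof.
case/dvdnP=> k ->; rewrite -(@Gauss_dvdl 4 _ 3) //.
have := bin_ffact (k * 4).*2.+1 3; rewrite !ffactnS ffactn0 /= => def.
apply/dvdnP; exists ((k * 4).*2.+1 * (k * ((k * 4).*2).-1)).
have f3 : 3`! = 6 by [].
move: def; rewrite f3; nia.
Qed.

(** The windows are the good arcs, and (x, d1, d2) can be followed by
    (x + d1, d2, d1). The prefix of this window is x, x + d1. For connectedness:
    the gaps (1, 1) connect all the words x, x + 1; the gaps (d, 1) connect
    x, x + d to x + d, x + d + 1 when d < h; the gaps (h, 2) connect x, x + h to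
    x + h, x + h + 2; and no good gap exceeds h. *)
Lemma triple_cycle h : 4 %| h -> 4 <= h -> ~~ (3 %| h.*2.+1) ->
  exists (L : nat) (w : 'I_L -> seq 'I_h.*2.+1),
    [/\ 4 %| L, tour 3 (fun=> True) w (@ordS _) &
        forall i, exists (x : 'I_h.*2.+1) (d : 'I_h),
          take 2 (w i) = [:: x; shift x d.+1]].
Proof.
move=> h4 h_ge4 n3; set n := h.*2.
pose E := {e : 'I_n.+1 * 'I_n.+1 * 'I_n.+1 | good_gaps h e.1.2 e.2}.
pose w (e : E) := arc3 (val e).1.1 (val e).1.2 (val e).2.
pose s0 (e : 'I_n.+1 * 'I_n.+1 * 'I_n.+1) := (shift e.1.1 e.1.2, e.2, e.1.2).
have s0P (e : E) : good_gaps h (s0 (val e)).1.2 (s0 (val e)).2.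
  by rewrite good_gaps_sym; apply: (valP e).
pose s (e : E) : E := exist _ (s0 (val e)) (s0P e).
have s0_inj : injective s0.
  move=> [[x d1] d2] [[x' d1'] d2'] eq_s.
  have := congr1 (fun p => p.1.1) eq_s; have := congr1 (fun p => p.1.2) eq_s.
  have /= := congr1 (fun p => p.2) eq_s.
  by move=> -> -> /(@shift_inj _ d1' x x') ->.
have w_tour : tour 3 (fun=> True) w s.
  split=> //.
  - by move=> e e' /(congr1 val)/s0_inj/val_inj.
  - move=> e; have /and4P[d1 d2 d12 _] := valP e; exact: arc3_uniq.
  - by move=> e; rewrite /= shiftD.
  - move=> e e' eq_set.
    have [ex e1 e2] := arc3_once n3 (valP e) (valP e') eq_set.
    apply: val_inj; move: ex (val_inj e1) (val_inj e2).
    by case: (val e) (val e') => [[x d1] d2] [[x' d1'] d2'] /= -> -> ->.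
  move=> S cardS _; have [x [d1 [d2 [good ->]]]] := arc3_all n3 cardS.
  have /and4P[d1_gt0 d2_gt0 d12 _] := good.
  have lt1 : d1 < n.+1 by lia.
  have lt2 : d2 < n.+1 by lia.
  by exists (exist _ (x, Ordinal lt1, Ordinal lt2) good).
have w_conn c : tour_invariant 3 w c -> forall e f, c (take 2 (w e)) = c (take 2 (w f)).
  move=> c_inv.
  have step (x : 'I_n.+1) d1 d2 : good_gaps h d1 d2 ->
      c [:: x; shift x d1] = c [:: shift x d1; shift x (d1 + d2)].
    move=> good; have /and4P[d1_gt0 d2_gt0 d12 _] := good.
    have lt1 : d1 < n.+1 by lia.
    have lt2 : d2 < n.+1 by lia.
    exact: (c_inv (exist _ (x, Ordinal lt1, Ordinal lt2) good)).
  have step1 d : 0 < d < h -> good_gaps h d 1.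
    by rewrite /good_gaps /gap_key; do !case: eqP; lia.
  have steph : good_gaps h h 2.
    by rewrite /good_gaps /gap_key; do !case: eqP; lia.
  pose K := c [:: ord0; shift ord0 1].
  have c1 x : c [:: x; shift x 1] = K.
    apply: (@shift1_invariant _ _ (fun x => c [:: x; shift x 1])) => {}x.
    by rewrite shiftD -step // step1 //; lia.
  have cd x d : 0 < d < h -> c [:: x; shift x d] = K.
    by move=> /step1/step ->; rewrite -shiftD c1.
  have c_all x d : 0 < d <= h -> c [:: x; shift x d] = K.
    move=> dh; have [->|ne] := eqVneq d h; last by apply: cd; lia.
    by rewrite (step _ _ _ steph) -shiftD cd; lia.
  have cw (e : E) : c (take 2 (w e)) = K.
    have := valP e; rewrite /= => good; apply: c_all; have := good_gaps_le good.
    by case/and4P: good => ->.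
  by move=> e f; rewrite !cw.
have [t t_tour] := tour_circuit w_tour w_conn.
exists _, (w \o t); split=> // [|i].
  by rewrite (card_tour w_tour) card_ord; apply: dvd4_bin3.
rewrite /w /=; case: (t i) => -[[x d1] d2] /= good.
have d1h := good_gaps_le good; have /and4P[d1_gt0 _ _ _] := good.
have lt_h : d1.-1 < h by lia.
by exists x, (Ordinal lt_h); rewrite /= prednK.
Qed.

(** * Inserting one symbol *)

(** In a string u_0 u_1 u_2 b u_3 u_4 u_5 b' and so on, the symbol b enters a
    window on the right, next to the triple 0, and moves one place to the left
    whenever the triple advances; once it is leftmost, next to the triple 3, it
    leaves and b' enters on the right while the triple 3 stays. The slot counts
    these places from the right. With the symbol b + 1 entering after b, the sum
    of the two indices increases by one at every step, so the slot is this sum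
    modulo 4, and each triple meets each symbol in one slot only. *)
Definition slot (L M : nat) (e : 'I_L * 'I_M) : nat := (e.1 + e.2) %% 4.

Definition insert_window (A T : Type) (L M : nat) (f : A -> T) (g : 'I_M -> T)
    (w : 'I_L -> seq A) (e : 'I_L * 'I_M) : seq T :=
  let l := map f (w e.1) in
  take (3 - slot e) l ++ g e.2 :: drop (3 - slot e) l.

Definition insert_next (L M : nat) (e : 'I_L * 'I_M) : 'I_L * 'I_M :=
  if slot e == 3 then (e.1, ordS e.2) else (ordS e.1, e.2).

Lemma slot_next (L M : nat) (e : 'I_L * 'I_M) : 4 %| L -> 4 %| M ->
  slot (insert_next e) = (slot e).+1 %% 4.
Proof.
move=> L4 M4.
have -> : (slot e).+1 %% 4 = (e.1 + e.2).+1 %% 4 by rewrite /slot; lia.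
rewrite /insert_next; case: ifP => _; rewrite /slot /=.
  by rewrite -modnDmr (modn_dvdm _ M4) modnDmr addnS.
by rewrite -modnDml (modn_dvdm _ L4) modnDml addSn.
Qed.

Lemma slot_lt L M (e : 'I_L * 'I_M) : slot e < 4.
Proof. exact: ltn_pmod. Qed.

Lemma insert_tour (A T : finType) (L M : nat) (f : A -> T) (g : 'I_M -> T)
    (w : 'I_L -> seq A) :
  4 %| L -> 4 %| M -> injective f -> injective g ->
  (forall x j, f x != g j) ->
  tour 3 (fun=> True) w (@ordS _) ->
  tour 4 (fun S => exists (X : {set A}) (j : 'I_M),
            #|X| = 3 /\ S = g j |: f @: X)
    (insert_window f g w) (@insert_next L M).
Proof.
move=> L4 M4 f_inj g_inj fg [_ w_size w_uniq w_next _ w_once w_all].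
have permE e : perm_eq (insert_window f g w e) (g e.2 :: map f (w e.1)).
  rewrite /insert_window; set l := map _ _.
  by rewrite (perm_catCA _ [:: _]) perm_cons cat_take_drop.
have gNf j l : g j \notin map f l.
  by apply/mapP=> -[x _ eq_g]; have := fg x j; rewrite eq_g eqxx.
have setE e : [set z in insert_window f g w e] = g e.2 |: f @: [set z in w e.1].
  rewrite (set_in_perm (permE e)); apply/setP=> z; rewrite !inE; congr orb.
  by apply/mapP/imsetP=> -[x xw ->]; exists x; rewrite ?inE // in xw *.
have cardw i : #|[set z in w i]| = 3 by rewrite cardsE (card_uniqP (w_uniq i)).
have gNf' j (X : {set A}) : g j \notin f @: X.
  by apply/imsetP=> -[x _ eq_g]; have := fg x j; rewrite eq_g eqxx.
split=> [e e'|e|e|e|e|e e'|S cardS [X [j [cardX ->]]]].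
- move=> eq_s; have eq_slot : slot e = slot e'.
    have := congr1 (@slot L M) eq_s; rewrite !slot_next //.
    by have := slot_lt e; have := slot_lt e'; lia.
  move: eq_s; rewrite /insert_next -eq_slot.
  case: e e' {eq_slot} => [i j] [i' j']; case: eqP => _ /= eq_s.
    by have /= -> := congr1 fst eq_s; have /= /ordS_inj -> := congr1 snd eq_s.
  by have /= /ordS_inj -> := congr1 fst eq_s; have /= -> := congr1 snd eq_s.
- by rewrite (perm_size (permE e)) /= size_map w_size.
- by rewrite (perm_uniq (permE e)) /= map_inj_uniq // w_uniq gNf.
- have := slot_next e L4 M4; have := slot_lt e.
  rewrite /insert_window; case def: (slot e) => [|[|[|[|]]]] // _ ->;
    rewrite /insert_next def /=; set i := e.1;
    have := w_next i; have := w_size i; have := w_size (ordS i);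
    case: (w i) => [|x [|y [|z [|? ?]]]] //;
    case: (w (ordS i)) => [|x' [|y' [|z' [|? ?]]]] //= _ _ [-> ->] //.
- by exists [set z in w e.1], e.2; split.
- rewrite /= !setE => eq_set.
  have eq2 : e.2 = e'.2.
    have /setP/(_ (g e.2)) := eq_set; rewrite !inE eqxx /= => /esym.
    by rewrite (negPf (gNf' _ _)) orbF => /eqP/g_inj.
  have eq1 : e.1 = e'.1.
    apply: w_once; apply/(imset_inj f_inj)/setP=> z.
    have /setP/(_ z) := eq_set; rewrite !inE eq2.
    case: eqP => //= ->; rewrite !(negPf (gNf' _ _)) //.
  by case: e e' eq1 eq2 {eq_set} => i j [i' j'] /= -> ->.
by have [i <-] := w_all X cardX I; exists (i, j); rewrite setE.
Qed.

(** The orbits of the successor run through the four slots cyclically, so every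
    one of them passes through a window of the form x b y z. *)
Lemma insert_connected (A T : finType) (L M : nat) (f : A -> T) (g : 'I_M -> T)
    (w : 'I_L -> seq A) (c : seq T -> bool) (K : bool) :
  4 %| L -> 4 %| M ->
  tour 4 (fun S => exists (X : {set A}) (j : 'I_M),
            #|X| = 3 /\ S = g j |: f @: X)
    (insert_window f g w) (@insert_next L M) ->
  (forall i, size (w i) = 3) ->
  tour_invariant 4 (insert_window f g w) c ->
  (forall i j x y, take 2 (w i) = [:: x; y] -> c [:: f x; g j; f y] = K) ->
  forall e, c (take 3 (insert_window f g w e)) = K.
Proof.
move=> L4 M4 w_tour w_size c_inv cK.
pose F e := c (take 3 (insert_window f g w e)).
have Fnext e : F (insert_next e) = F e.
  by rewrite /F (tour_next w_tour) -c_inv.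
have F2 e : slot e = 2 -> F e = K.
  move=> slot2; rewrite /F /insert_window slot2; have := w_size e.1.
  have := @cK e.1 e.2; case: (w e.1) => [|x [|y [|z [|? ?]]]] //= cxy _.
  by apply: cxy.
have F1 e : slot e = 1 -> F e = K.
  by move=> slot1; rewrite -Fnext F2 // slot_next // slot1.
have F0 e : slot e = 0 -> F e = K.
  by move=> slot0; rewrite -Fnext F1 // slot_next // slot0.
move=> e; have := slot_lt e; case def: (slot e) => [|[|[|[|]]]] // _.
- exact: F0.
- exact: F1.
- exact: F2.
by rewrite -/(F e) -Fnext F0 // slot_next // def.
Qed.

(** * Renaming symbols *)

(** Both words extend to enumerations, which are then matched. *)
Lemma relabelling (T1 : finType) (T2 : eqType) (x0 : T1) (y0 : T2)
    (l1 : seq T1) (l2 s2 : seq T2) :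
  uniq l1 -> uniq l2 -> uniq s2 -> {subset l2 <= s2} -> size s2 = #|T1| ->
  size l1 = size l2 ->
  exists phi : T1 -> T2,
    [/\ injective phi, map phi l1 = l2 & codom phi =i s2].
Proof.
move=> u1 u2 us sub size_s size_l.
have complete (T : eqType) (l s : seq T) : uniq l -> uniq s -> {subset l <= s} ->
    exists l', perm_eq (l ++ l') s.
  move=> ul us' sub_l; exists [seq z <- s | z \notin l].
  apply: uniq_perm => // [|z].
    rewrite cat_uniq ul filter_uniq // andbT /=; apply/hasPn=> z.
    by rewrite mem_filter => /andP[].
  rewrite mem_cat mem_filter; case zl: (z \in l) => //=.
  by rewrite (sub_l _ zl).
have [l2' p2] := complete _ _ _ u2 us sub.
have [l1' p1] := complete _ l1 (enum T1) u1 (enum_uniq _) (fun z _ => mem_enum T1 z).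
have size_l' : size (l1 ++ l1') = size (l2 ++ l2').
  by rewrite (perm_size p1) (perm_size p2) -cardT size_s.
have mem1 x : x \in l1 ++ l1' by rewrite (perm_mem p1) mem_enum.
have u1' : uniq (l1 ++ l1') by rewrite (perm_uniq p1) enum_uniq.
have u2' : uniq (l2 ++ l2') by rewrite (perm_uniq p2).
pose phi x := nth y0 (l2 ++ l2') (index x (l1 ++ l1')).
have idx x : index x (l1 ++ l1') < size (l2 ++ l2').
  by rewrite -size_l' index_mem.
exists phi; split.
- move=> x x' /eqP; rewrite nth_uniq // => /eqP eq_i.
  by rewrite -(nth_index x (mem1 x)) -(nth_index x (mem1 x')) eq_i.
- apply: (@eq_from_nth _ y0); rewrite size_map // => i il.
  rewrite (nth_map x0) // /phi index_cat mem_nth // index_uniq //.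
  by rewrite nth_cat -size_l il.
move=> z; rewrite -(perm_mem p2); apply/codomP/idP => [[x ->]|zl].
  exact: mem_nth.
exists (nth x0 (l1 ++ l1') (index z (l2 ++ l2'))).
by rewrite /phi index_uniq ?nth_index // size_l' index_mem.
Qed.

(** * Splitting the ground set *)

Definition splits (A B T : finType) (f : A -> T) (g : B -> T) : Prop :=
  [/\ injective f, injective g, (forall x y, f x != g y)
    & forall z, (z \in codom f) || (z \in codom g)].

Lemma splitsC (A B T : finType) (f : A -> T) (g : B -> T) :
  splits f g -> splits g f.
Proof.
by case=> f_inj g_inj fg cover; split=> // [x y|z]; [rewrite eq_sym | rewrite orbC].
Qed.

Lemma splits_setE (A B T : finType) (f : A -> T) (g : B -> T) (S : {set T}) :
  splits f g -> S = f @: (f @^-1: S) :|: g @: (g @^-1: S).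
Proof.
case=> _ _ _ cover; apply/setP=> z; rewrite inE; apply/idP/orP=> [zS|].
  by case/orP: (cover z) => /codomP[x def]; [left|right];
     apply/imsetP; exists x; rewrite // inE -def.
by case=> /imsetP[x]; rewrite inE => ? ->.
Qed.

Lemma preim_union (A B T : finType) (f : A -> T) (g : B -> T)
    (X : {set A}) (Y : {set B}) :
  splits f g -> f @^-1: (f @: X :|: g @: Y) = X.
Proof.
case=> f_inj _ fg _; apply/setP=> x; rewrite !inE mem_imset //.
case: imsetP => [[y _ eq_fg]|]; last by rewrite orbF.
by have := fg x y; rewrite eq_fg eqxx.
Qed.

Lemma splits_card (A B T : finType) (f : A -> T) (g : B -> T) (S : {set T}) :
  splits f g -> #|S| = #|f @^-1: S| + #|g @^-1: S|.
Proof.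
move=> fg; rewrite {1}(splits_setE S fg).
have [f_inj g_inj fNg _] := fg; rewrite cardsU !card_imset //.
rewrite (_ : _ :&: _ = set0) ?cards0 ?subn0 //; apply/setP=> z; rewrite !inE.
apply/andP=> -[/imsetP[x _ ->] /imsetP[y _ eq_fg]].
by have := fNg x y; rewrite eq_fg eqxx.
Qed.

Lemma set_in_map (A B T : finType) (f : A -> T) (g : B -> T)
    (l1 : seq A) (l2 : seq B) :
  [set z in map f l1 ++ map g l2] = f @: [set x in l1] :|: g @: [set y in l2].
Proof.
apply/setP=> z; rewrite !inE mem_cat; congr orb;
  by apply/mapP/imsetP=> -[x xl ->]; exists x; rewrite ?inE // in xl *.
Qed.

(** * Two symbols on either side *)

Definition alternate_window (h h' : nat) (T : Type) (f : 'I_h.*2.+1 -> T)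
    (g : 'I_h'.*2.+1 -> T)
    (e : ('I_h.*2.+1 * 'I_h) * ('I_h'.*2.+1 * 'I_h')) : seq T :=
  let: ((x, d), (y, d')) := e in
  if odd (d + d') then [:: g y; f x; g (shift y d'.+1); f (shift x d.+1)]
  else [:: f x; g y; f (shift x d.+1); g (shift y d'.+1)].

Definition alternate_next (h h' : nat)
    (e : ('I_h.*2.+1 * 'I_h) * ('I_h'.*2.+1 * 'I_h')) :
    ('I_h.*2.+1 * 'I_h) * ('I_h'.*2.+1 * 'I_h') :=
  let: ((x, d), (y, d')) := e in
  if odd (d + d') then ((x, d), (shift y d'.+1, rev_ord d'))
  else ((shift x d.+1, rev_ord d), (y, d')).

Lemma odd_rev_ord h (d : 'I_h) : ~~ odd h -> odd (rev_ord d) = ~~ odd d.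
Proof. by move=> h2; rewrite /= oddB // (negPf h2). Qed.

(** The window x y (x + d) (y + d') with d + d' even is followed by
    y (x + d) (y + d') (x + d + e), where e is the difference paired with d by
    the involution that reverses the list of differences. It exchanges the two
    parities since the number h of differences is even. The indices d and d'
    start from 0: they stand for the differences d + 1 and d' + 1. *)
Lemma alternate_tour (h h' : nat) (T : finType) (f : 'I_h.*2.+1 -> T)
    (g : 'I_h'.*2.+1 -> T) :
  splits f g -> ~~ odd h -> ~~ odd h' ->
  tour 4 (fun S => #|f @^-1: S| = 2)
    (alternate_window f g) (@alternate_next h h').
Proof.
move=> fg h2 h'2; have [f_inj g_inj fNg cover] := fg.
have permE x d y d' : perm_eq (alternate_window f g ((x, d), (y, d')))
    (map f [:: x; shift x d.+1] ++ map g [:: y; shift y d'.+1]).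
  rewrite /alternate_window; case: ifP => _ /=; apply/seq.permP=> p /=; lia.
have setE x d y d' : [set z in alternate_window f g ((x, d), (y, d'))] =
    f @: [set z in [:: x; shift x d.+1]] :|: g @: [set z in [:: y; shift y d'.+1]].
  by rewrite (set_in_perm (permE x d y d')) set_in_map.
split=> [||||||].
- move=> e1 e2 eq_next.
  have parity : odd (e1.1.2 + e1.2.2) = odd (e2.1.2 + e2.2.2).
    have next_parity (e : ('I_h.*2.+1 * 'I_h) * ('I_h'.*2.+1 * 'I_h')) :
        odd ((alternate_next e).1.2 + (alternate_next e).2.2)
        = ~~ odd (e.1.2 + e.2.2).
      case: e => [[x d] [y d']] /=; case: ifP => <-.
        by rewrite oddD odd_rev_ord // oddD addbN.
      by rewrite oddD odd_rev_ord // oddD addNb.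
    by apply: negb_inj; rewrite -!next_parity eq_next.
  move: eq_next parity; case: e1 e2 => [[x1 d1] [y1 d1']] [[x2 d2] [y2 d2']].
  rewrite /alternate_next /= => eq_next parity; move: eq_next.
  rewrite -parity; case: ifP => _ eq_next.
    have := congr1 (fun e => e.2.1) eq_next.
    have := congr1 (fun e => e.1) eq_next.
    have := congr1 (fun e => e.2.2) eq_next.
    by move=> /= /rev_ord_inj -> -> /(@shift_inj _ _ y1 y2) ->.
  have := congr1 (fun e => e.1.1) eq_next.
  have := congr1 (fun e => e.2) eq_next.
  have := congr1 (fun e => e.1.2) eq_next.
  by move=> /= /rev_ord_inj -> -> /(@shift_inj _ _ x1 x2) ->.
- by move=> [[x d] [y d']] /=; case: ifP.
- move=> [[x d] [y d']]; rewrite (perm_uniq (permE x d y d')) cat_uniq.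
  rewrite !map_inj_uniq // !pair_uniq andbT /=.
  by rewrite !inE !negb_or ![g _ == _]eq_sym !fNg.
- move=> [[x d] [y d']] /=; case par: (odd (d + d')); rewrite /= !oddD.
    by rewrite odd_rev_ord // addbN -oddD par.
  by rewrite odd_rev_ord // addNb -oddD par.
- move=> [[x d] [y d']]; rewrite setE preim_union //.
  by rewrite cardsE (card_uniqP (pair_uniq x d)).
- move=> [[x1 d1] [y1 d1']] [[x2 d2] [y2 d2']]; rewrite !setE => eq_set.
  have := congr1 (fun S : {set T} => f @^-1: S) eq_set.
  have := congr1 (fun S : {set T} => g @^-1: S) eq_set.
  rewrite ![f @: _ :|: _]setUC !(preim_union _ _ (splitsC fg)) => /pair_once[-> ->].
  by rewrite ![g @: _ :|: _]setUC !(preim_union _ _ fg) => /pair_once[-> ->].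
move=> S cardS cardA; have cardB : #|g @^-1: S| = 2.
  by have := splits_card S fg; lia.
have [x [d defA]] := pair_all cardA; have [y [d' defB]] := pair_all cardB.
by exists ((x, d), (y, d')); rewrite setE -defA -defB -splits_setE.
Qed.

(** Two successive windows connect x, y, x + d to x + d, y + d', x + d + e, for
    any d' of the parity of d and any e of the other parity. Replacing d' by
    d' + 2 shows that the colour does not depend on y; comparing d = 0 followed
    by 1 or by 3 shows that it does not depend on x either. *)
Lemma alternate_connected (h h' : nat) (T : finType) (f : 'I_h.*2.+1 -> T)
    (g : 'I_h'.*2.+1 -> T) (c : seq T -> bool) :
  ~~ odd h -> ~~ odd h' -> 4 <= h -> 4 <= h' ->
  tour_invariant 4 (alternate_window f g) c ->
  exists K : bool,
    [/\ forall x (d : 'I_h) y, c [:: f x; g y; f (shift x d.+1)] = K,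
        forall y (d : 'I_h') x, c [:: g y; f x; g (shift y d.+1)] = K
      & forall e, c (take 3 (alternate_window f g e)) = K].
Proof.
move=> h2 h'2 h4 h'4 c_inv.
pose R x (d : nat) y := c [:: f x; g y; f (shift x d.+1)].
pose R' y (d' : nat) x := c [:: g y; f x; g (shift y d'.+1)].
have even_step x d y d' : d < h -> d' < h' -> ~~ odd (d + d') ->
    R x d y = R' y d' (shift x d.+1).
  move=> dh dh' par; have := c_inv ((x, Ordinal dh), (y, Ordinal dh')).
  by rewrite /= (negPf par).
have odd_step x d y d' : d < h -> d' < h' -> odd (d + d') ->
    R' y d' x = R x d (shift y d'.+1).
  move=> dh dh' par; have := c_inv ((x, Ordinal dh), (y, Ordinal dh')).
  by rewrite /= par.
have move_both x d e y d' : d < h -> e < h -> d' < h' -> ~~ odd (d + d') ->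
    odd (e + d') -> R x d y = R (shift x d.+1) e (shift y d'.+1).
  by move=> dh eh dh' par1 par2; rewrite (even_step _ _ _ _ dh dh' par1) (odd_step _ e).
have pick_parity m b : 4 <= m -> exists d, [/\ d < m, d.+2 < m & odd d = b].
  by move=> m4; exists (nat_of_bool b); case: b; split=> //; lia.
have R_y e X y y' : e < h -> R X e y = R X e y'.
  move=> eh; apply: (@shift2_invariant _ _ (R X e)) => {y'}y.
  have [d [dh _ par_d]] := pick_parity h (~~ odd e) h4.
  have [d' [d'h d''h par_d']] := pick_parity h' (odd d) h'4.
  have [x ->] := unshift X d.+1; have [z ->] := unshift y d'.+1.
  rewrite shiftD -(@move_both x d e z d') ?oddD ?par_d' ?par_d ?addbb //; last first.
    by rewrite addbN addbb.
  have -> : d'.+1 + 2 = d'.+3 by lia.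
  rewrite -(@move_both x d e z d'.+2) // ?oddD /= ?negbK ?par_d' ?par_d ?addbb //.
  by rewrite addbN addbb.
have R_x e d x y : d < h -> e < h -> odd e != odd d ->
    R x d y = R (shift x d.+1) e y.
  move=> dh eh ne; have [d' [d'h _ par_d']] := pick_parity h' (odd d) h'4.
  rewrite (@move_both x d e y d') ?oddD ?par_d' ?addbb //; first exact: R_y.
  by move: ne; case: (odd e) (odd d) => -[].
pose K := R ord0 0 ord0.
have R0 x y : R x 0 y = K.
  rewrite (R_y _ _ _ ord0) //; last lia.
  apply: (@shift2_invariant _ _ (fun x => R x 0 ord0)) => {y}x.
  (* The words with index 0 at z + 3 and z + 5 are reached from the one at z
     through those with indices 1 and 3 at z + 1. *)
  have [z ->] := unshift x 3; rewrite shiftD.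
  have -> : shift z 3 = shift (shift z 1) 2 by rewrite shiftD.
  have -> : shift z (3 + 2) = shift (shift z 1) 4 by rewrite shiftD.
  rewrite -(@R_x 0 1) -?(@R_x 0 3) -?(@R_x 1 0) -?(@R_x 3 0) //; lia.
have R_odd d x y : d < h -> odd d -> R x d y = K.
  by move=> dh odd_d; rewrite (@R_x 0) ?R0 ?odd_d //; lia.
have R_all d x y : d < h -> R x d y = K.
  move=> dh; case odd_d: (odd d); first exact: R_odd.
  by rewrite (@R_x 1) ?R_odd ?odd_d //; lia.
have R'_all d' y x : d' < h' -> R' y d' x = K.
  move=> d'h; have [d [dh _ par_d]] := pick_parity h (odd d') h4.
  have [z ->] := unshift x d.+1.
  by rewrite -even_step ?R_all // oddD par_d addbb.
exists K; split=> [x d y|y d' x|[[x d] [y d']]]; [exact: R_all|exact: R'_all|].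
rewrite /alternate_window; case: ifP => _; first exact: (R'_all d').
exact: (R_all d).
Qed.

(** * Three symbols on one side *)

(** The symbols of a universal cycle can be renamed so that it contains any
    prescribed word l. *)
Lemma relabelled_cycle (k n m : nat) (T : finType) (C : m.+1.-tuple 'I_n)
    (t0 : T) (s : seq T) (l : seq T) :
  universal_cycle k.+1 [set: 'I_n] C ->
  uniq s -> size s = n -> uniq l -> size l = k -> {subset l <= s} ->
  exists w : 'I_m.+1 -> seq T,
    tour k.+1 (fun S : {set T} => {subset S <= s}) w (@ordS _) /\
    (forall c, tour_invariant k.+1 w c -> forall x, c (take k (w x)) = c l).
Proof.
move=> C_cycle us size_s ul size_l sub.
pose w0 (x : 'I_m.+1) := [seq cycle_sym C (x + i) | i <- iota 0 k.+1].
have w0_tour : tour k.+1 (fun=> True) w0 (@ordS _) := universal_cycle_tour C_cycle.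
have u0 : uniq (take k (w0 ord0)) by rewrite take_uniq ?(tour_uniq w0_tour).
have size0 : size (take k (w0 ord0)) = size l.
  by rewrite size_takel ?(tour_size w0_tour).
have cardT : size s = #|'I_n| by rewrite card_ord.
have [phi [phi_inj phi_l phi_s]] :=
  relabelling (tnth C ord0) t0 u0 ul us sub cardT size0.
have w_tour := tour_map phi_inj w0_tour.
exists (fun x => map phi (w0 x)); split=> [|c c_inv x].
  apply: tour_ext w_tour => S _; split=> [/subsetP Sphi z zS|Ss].
    by rewrite -phi_s Sphi.
  by apply/subsetP=> z zS; rewrite phi_s Ss.
rewrite -phi_l map_take.
apply: (@shift1_invariant _ _ (fun x => c (take k (map phi (w0 x))))) => {}x.
have -> : shift x 1 = ordS x by apply: val_inj; rewrite /= addn1.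
by have /= -> := tour_next w_tour x; rewrite -c_inv.
Qed.

(** The tour joins the renamed universal cycle on the image of f and p, where
    p is the last element of the image of g, to the insertions of the other
    elements of that image into the cycle of triples. The prescribed word is f 0, p, f 1. *)
Lemma side_tour (h h' : nat) (T : finType) (f : 'I_h.*2.+1 -> T)
    (g : 'I_h'.*2.+1 -> T) :
  splits f g -> 4 %| h -> 4 <= h -> ~~ (3 %| h.*2.+1) -> ~~ odd h' ->
  has_universal_cycle 4 (h.*2 + 2) ->
  exists (E : finType) (w : E -> seq T) (s : E -> E),
    tour 4 (fun S => 3 <= #|f @^-1: S|) w s /\
    (forall c K, tour_invariant 4 w c ->
       (forall x (d : 'I_h) y, c [:: f x; g y; f (shift x d.+1)] = K) ->
       forall e, c (take 3 (w e)) = K).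
Proof.
move=> fg h4 h_ge4 n3 h'2 [m [C C_cycle]]; have [f_inj g_inj fNg cover] := fg.
pose p := g ord_max; pose sA := p :: codom f.
have pNf : p \notin codom f.
  by apply/codomP=> -[x eq_p]; have := fNg x ord_max; rewrite -eq_p eqxx.
have u_sA : uniq sA by rewrite /= pNf map_inj_uniq ?enum_uniq.
have size_sA : size sA = h.*2 + 2 by rewrite /= size_codom card_ord addn2.
pose x1 : 'I_h.*2.+1 := shift ord0 1.
have u_l : uniq [:: f ord0; p; f x1].
  rewrite /= !inE negb_or fNg [p == _]eq_sym fNg (inj_eq f_inj) !andbT /=.
  by apply/eqP=> /esym; apply: shift_neq; lia.
have sub_l : {subset [:: f ord0; p; f x1] <= sA}.
  by move=> z; rewrite !inE => /or3P[] /eqP->; rewrite ?codom_f ?eqxx ?orbT.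
have [w1 [w1_tour w1_conn]] :=
  relabelled_cycle p C_cycle u_sA size_sA u_l erefl sub_l.
have [L [u [L4 u_tour u_steps]]] := triple_cycle h4 h_ge4 n3.
pose g' (j : 'I_h'.*2) := g (lift ord_max j).
have g'_inj : injective g' by move=> j j' /g_inj /lift_inj.
have fNg' x j : f x != g' j by apply: fNg.
have M4 : 4 %| h'.*2 by lia.
have w2_tour := insert_tour L4 M4 f_inj g'_inj fNg' u_tour.
have w2_conn := insert_connected L4 M4 w2_tour (tour_size u_tour).
have g'NA j : g' j \notin sA.
  rewrite inE negb_or (inj_eq g_inj) eq_sym neq_lift.
  by apply/codomP=> -[x eq_g]; have := fNg' x j; rewrite -eq_g eqxx.
have disj (S : {set T}) : {subset S <= sA} ->
    (exists (X : {set 'I_h.*2.+1}) (j : 'I_h'.*2),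
       #|X| = 3 /\ S = g' j |: f @: X) -> False.
  move=> SA [X [j [_ def]]]; have /negP := g'NA j; apply; apply: SA.
  by rewrite def setU11.
exists _, (sum_windows w1 (insert_window f g' u)),
  (sum_next (@ordS _) (@insert_next L h'.*2)); split.
  apply: tour_ext (tour_sum disj w1_tour w2_tour) => S cardS.
  split=> [[SA|[X [j [cardX ->]]]]|card_f].
  - have : #|S| <= #|p |: f @: (f @^-1: S)|.
      apply/subset_leq_card/subsetP=> z zS; rewrite in_setU1.
      have := SA z zS; rewrite inE => /predU1P[->|/codomP[x def]].
        by rewrite eqxx.
      by rewrite def imset_f ?orbT // inE -def.
    rewrite cardsU1 card_imset // cardS; case: (_ \notin _) => /=; lia.
  - rewrite -cardX; apply/subset_leq_card/subsetP=> x xX.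
    by rewrite !inE imset_f ?orbT.
  have [/allP SA|] := boolP (all (mem sA) (enum S)).
    by left=> z zS; apply: SA; rewrite mem_enum.
  case/allPn=> z; rewrite mem_enum => zS; rewrite -[mem sA z]/(z \in sA) => zNA; right.
  have fS : f @: (f @^-1: S) \subset S.
    by apply/subsetP=> _ /imsetP[x xS ->]; rewrite inE in xS.
  have zNf : z \notin f @: (f @^-1: S).
    apply: contra zNA => /imsetP[x _ ->].
    by rewrite /sA in_cons codom_f orbT.
  have card_zf : #|z |: f @: (f @^-1: S)| = #|f @^-1: S|.+1.
    by rewrite cardsU1 zNf card_imset.
  have sub : z |: f @: (f @^-1: S) \subset S by rewrite subUset sub1set zS.
  have := subset_leq_card sub; rewrite card_zf cardS => le_f.
  have [/codomP[x def]|/codomP[y def]] := orP (cover z).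
    by case/negP: zNA; rewrite def /sA in_cons codom_f orbT.
  have y_ne : ord_max != y.
    by apply: contra zNA => /eqP eq_y; rewrite def -eq_y inE eqxx.
  have [j def_y _] := unlift_some y_ne.
  exists (f @^-1: S), j; split; first by apply/eqP; rewrite eqn_leq card_f andbT -ltnS.
  apply/esym/eqP; rewrite eqEcard cardS /g' -def_y -def sub card_zf; lia.
move=> c K c_inv cK.
have h_gt0 : 0 < h by lia.
have c1 : tour_invariant 4 w1 c by move=> e; apply: (c_inv (inl e)).
have c2 : tour_invariant 4 (insert_window f g' u) c.
  by move=> e; apply: (c_inv (inr e)).
case=> e /=; first by rewrite (w1_conn c c1) (cK _ (Ordinal h_gt0)).
apply: w2_conn => // i j x y; have [x' [d ->]] := u_steps i.
by case=> <- <-; apply: cK.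
Qed.

Theorem mainTheorem1 (a b : nat)
  (a_gt0 : 0 < a) (b_gt0 : 0 < b)
  (a_dvd8 : 8 %| a) (b_dvd8 : 8 %| b)
  (a_ndvd3 : ~~ (3 %| a + 1)) (b_ndvd3 : ~~ (3 %| b + 1)) :
  has_universal_cycle 4 (a + 2) ->
  has_universal_cycle 4 (b + 2) ->
  has_universal_cycle 4 (a + b + 2).
Proof.
have half n : 0 < n -> 8 %| n -> ~~ (3 %| n + 1) ->
    exists h, [/\ n = h.*2, 4 %| h, 4 <= h, ~~ odd h & ~~ (3 %| h.*2.+1)].
  by move=> n_gt0 n8 n3; exists n./2; split; lia.
have [h [-> h4 h_ge4 h2 n3]] := half a a_gt0 a_dvd8 a_ndvd3.
have [h' [-> h'4 h'_ge4 h'2 n'3]] := half b b_gt0 b_dvd8 b_ndvd3.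
move=> {a b a_gt0 b_gt0 a_dvd8 b_dvd8 a_ndvd3 b_ndvd3 half} cycleA cycleB.
have card_eq : h.*2.+1 + h'.*2.+1 = h.*2 + h'.*2 + 2 by lia.
pose f x := cast_ord card_eq (lshift h'.*2.+1 x).
pose g y := cast_ord card_eq (rshift h.*2.+1 y).
have fg : splits f g.
  split.
  - by move=> x x' /cast_ord_inj /lshift_inj.
  - by move=> y y' /cast_ord_inj /rshift_inj.
  - by move=> x y; rewrite (inj_eq (@cast_ord_inj _ _ _)) eq_lrshift.
  move=> z; case def: (split (cast_ord (esym card_eq) z)) => [x|y].
    apply/orP; left; apply/codomP; exists x.
    by have := congr1 unsplit def; rewrite splitK /f /= => <-; rewrite cast_ordKV.
  apply/orP; right; apply/codomP; exists y.
  by have := congr1 unsplit def; rewrite splitK /g /= => <-; rewrite cast_ordKV.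
have gf := splitsC fg.
have [EA [wA [sA [tourA connA]]]] := side_tour fg h4 h_ge4 n3 h'2 cycleA.
have [EB [wB [sB [tourB connB]]]] := side_tour gf h'4 h'_ge4 n'3 h2 cycleB.
have tourM := alternate_tour fg h2 h'2.
have disjAM (S : {set 'I_(h.*2 + h'.*2 + 2)}) :
    3 <= #|f @^-1: S| -> #|f @^-1: S| = 2 -> False by lia.
have tourB' : tour 4 (fun S => #|f @^-1: S| <= 1) wB sB.
  have side n p q : n = p + q -> n = 4 -> 3 <= q <-> p <= 1 by lia.
  by apply: tour_ext tourB => S; apply: side (splits_card S fg).
have disjAMB (S : {set 'I_(h.*2 + h'.*2 + 2)}) :
    3 <= #|f @^-1: S| \/ #|f @^-1: S| = 2 -> #|f @^-1: S| <= 1 -> False by lia.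
have tour_all := tour_sum disjAMB (tour_sum disjAM tourA tourM) tourB'.
set w := sum_windows _ _ in tour_all; set s := sum_next _ _ in tour_all.
have {}tour_all : tour 4 (fun=> True) w s.
  by apply: tour_ext tour_all => S _; split=> // _; lia.
have conn c : tour_invariant 4 w c -> forall e e', c (take 3 (w e)) = c (take 3 (w e')).
  move=> c_inv.
  have cM : tour_invariant 4 (alternate_window f g) c.
    by move=> e; apply: (c_inv (inl (inr e))).
  have [K [K_A K_B K_M]] := alternate_connected h2 h'2 h_ge4 h'_ge4 cM.
  have cE e : c (take 3 (w e)) = K.
    case: e => [[e|e]|e]; [apply: connA K_A _|exact: K_M|apply: connB K_B _].
      by move=> e'; apply: (c_inv (inl (inl e'))).
    by move=> e'; apply: (c_inv (inr e')).
  by move=> e e'; rewrite !cE.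
have [t] := tour_circuit tour_all conn.
have := card_tour tour_all; rewrite card_ord.
have : 0 < 'C(h.*2 + h'.*2 + 2, 4) by rewrite bin_gt0; lia.
move: t; case: #|_| => [|m] t; first by lia.
move=> _ _ /(@tour_universal_cycle _ 4) [//|C C_cycle].
by exists m, C.
Qed.
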